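(* Let $G$ be a finite group, let $n\geq 1$ and let $\rho\colon G\to\mathrm{Aut}^+(\mathbb{R}^n)$ be a positive representation. Then there exist a unique permutation representation $\pi\colon G\to S_n\subset\mathrm{Aut}^+(\mathbb{R}^n)$ and an $m\in(\mathbb{R}_{>0})^n$ such that \[ \rho_s = m\,\pi_s\, m^{-1}\qquad\text{for all } s\in G. \] Conversely, any permutation representation $\pi\colon G\to S_n$ and any $m\in(\mathbb{R}_{>0})^n$ define a positive representation $\rho$ of $G$ in $\mathbb{R}^n$ by this equation.
   Context: $\mathbb{R}^n$ carries the coordinatewise ordering and $\mathrm{Aut}^+(\mathbb{R}^n)$ is its group of lattice automorphisms. A positive representation of $G$ in $\mathbb{R}^n$ is a group homomorphism $\rho\colon G\to\mathrm{Aut}^+(\mathbb{R}^n)$, $s\mapsto\rho_s$. The group $S_n$ is identified with the subgroup of permutation operators in $\mathrm{Aut}^+(\mathbb{R}^n)$: $\sigma\in S_n$ corresponds to the operator with $e_i\mapsto e_{\sigma(i)}$, where $e_1,\dots,e_n$ is the standard basis. An element $m\in(\mathbb{R}_{>0})^n$ is identified with the multiplication (diagonal) operator $e_i\mapsto m_i e_i$, and $m^{-1}$ is its inverse. A permutation representation is a group homomorphism $\pi\colon G\to S_n\subset\mathrm{Aut}^+(\mathbb{R}^n)$. *)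

(* Defs.v *)
From HB Require Import structures.
From mathcomp Require Import all_boot all_order all_fingroup all_algebra.
From mathcomp Require Import reals.

Set Implicit Arguments.
Unset Strict Implicit.
Unset Printing Implicit Defensive.

Import Order.TTheory GRing.Theory Num.Theory.

Local Open Scope ring_scope.

(* R^n is 'rV[R]_n; linear operators on it are elements of 'End('rV[R]_n),
   acting on the left by application, with composition (f \o g)%VF. *)

Definition rv_le (R : realType) (n : nat) (x y : 'rV[R]_n) : Prop :=
  forall i, x 0 i <= y 0 i.

Definition rv_join (R : realType) (n : nat) (x y : 'rV[R]_n) : 'rV[R]_n :=
  \row_i Num.max (x 0 i) (y 0 i).

Definition rv_meet (R : realType) (n : nat) (x y : 'rV[R]_n) : 'rV[R]_n :=
  \row_i Num.min (x 0 i) (y 0 i).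

Lemma rv_joinP (R : realType) (n : nat) (x y z : 'rV[R]_n) :
  rv_le (rv_join x y) z <-> rv_le x z /\ rv_le y z.
Proof.
split=> [h|[hx hy] i]; last by rewrite mxE ge_max hx hy.
by split=> i; move: (h i); rewrite mxE ge_max => /andP[].
Qed.

Lemma rv_meetP (R : realType) (n : nat) (x y z : 'rV[R]_n) :
  rv_le z (rv_meet x y) <-> rv_le z x /\ rv_le z y.
Proof.
split=> [h|[hx hy] i]; last by rewrite mxE le_min hx hy.
by split=> i; move: (h i); rewrite mxE le_min => /andP[].
Qed.

(* Membership in Aut^+(R^n); linearity is carried by the type 'End. *)
Definition lattice_automorphism (R : realType) (n : nat)
    (T : 'End('rV[R]_n)) : Prop :=
  [/\ bijective T,
      {morph T : x y / rv_join x y} &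
      {morph T : x y / rv_meet x y}].

Definition positive_representation (R : realType) (gT : finGroupType) (n : nat)
    (rho : gT -> 'End('rV[R]_n)) : Prop :=
  (forall s, lattice_automorphism (rho s)) /\
  (forall s t, rho (s * t)%g = (rho s \o rho t)%VF).

(* S_n is a group here under composition of functions, (sigma tau)(i) =
   sigma (tau i), so that perm_op below is a homomorphism. The product of
   {perm T} is the opposite one, (sigma * tau) i = tau (sigma i), hence the
   pointwise formulation. *)
Definition permutation_representation (gT : finGroupType) (n : nat)
    (pi : gT -> 'S_n) : Prop :=
  forall s t, pi (s * t)%g =1 pi s \o pi t.

Definition perm_op (R : realType) (n : nat) (sigma : 'S_n) : 'End('rV[R]_n) :=
  linfun (fun x : 'rV[R]_n => \sum_i x 0 i *: delta_mx 0 (sigma i)).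

Definition mul_op (R : realType) (n : nat) (m : 'rV[R]_n) : 'End('rV[R]_n) :=
  linfun (fun x : 'rV[R]_n => \row_i (m 0 i * x 0 i)).

(* linfun f and f^-1%VF carry junk values when f is not linear, resp. not
   invertible; the following facts show that this does not happen here. *)

Lemma perm_op_delta (R : realType) (n : nat) (sigma : 'S_n) (i : 'I_n) :
  perm_op R sigma (delta_mx 0 i) = delta_mx 0 (sigma i).
Proof.
pose f (x : 'rV[R]_n) : 'rV[R]_n := \sum_j x 0 j *: delta_mx 0 (sigma j).
have lf : linear f.
  move=> a x y; rewrite /f scaler_sumr -big_split /=.
  by apply: eq_bigr => j _; rewrite !mxE scalerDl scalerA.
pose fL := GRing.isLinear.Build R 'rV[R]_n 'rV[R]_n *:%R f lf.
pose F : {linear 'rV[R]_n -> 'rV[R]_n} := HB.pack f fL.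
rewrite (lfunE F) /= /f (bigD1 i) //= mxE !eqxx scale1r big1 ?addr0 // => j ji.
by rewrite mxE (negPf ji) andbF scale0r.
Qed.

Lemma mul_opE (R : realType) (n : nat) (m x : 'rV[R]_n) :
  mul_op m x = \row_i (m 0 i * x 0 i).
Proof.
pose f (x : 'rV[R]_n) : 'rV[R]_n := \row_i (m 0 i * x 0 i).
have lf : linear f.
  by move=> a u v; apply/rowP => j; rewrite !mxE mulrDr mulrCA.
pose fL := GRing.isLinear.Build R 'rV[R]_n 'rV[R]_n *:%R f lf.
pose F : {linear 'rV[R]_n -> 'rV[R]_n} := HB.pack f fL.
by rewrite (lfunE F).
Qed.

Lemma mul_op_lker0 (R : realType) (n : nat) (m : 'rV[R]_n) :
  (forall i, 0 < m 0 i) -> lker (mul_op m) == 0%VS.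
Proof.
move=> m_gt0; apply/lker0P => x y; rewrite !mul_opE => /rowP e.
apply/rowP => i; move: (e i); rewrite !mxE.
by apply: mulfI; rewrite gt_eqF.
Qed.

Lemma mul_opV (R : realType) (n : nat) (m : 'rV[R]_n) :
  (forall i, 0 < m 0 i) ->
  ((mul_op m)^-1 \o mul_op m = \1)%VF /\ (mul_op m \o (mul_op m)^-1 = \1)%VF.
Proof.
by move=> /mul_op_lker0 m0; split; [exact: lker0_compVf | exact: lker0_compfV].
Qed.

(* Main.v *)
(* Lattice automorphisms send the disjoint vectors e_i to nonzero disjoint
   nonnegative vectors, hence are monomial: rho_s e_i = c_s(i) e_{pi_s(i)} with
   c_s(i) > 0, and such a form is unique. The vector m obtained by summing
   rho_t(1, ..., 1) over t in G is positive and fixed by rho, which reads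
   m_{pi_s(i)} = c_s(i) m_i. *)
Require Import Defs.
From mathcomp Require Import all_boot all_order all_fingroup all_algebra.
From mathcomp Require Import reals.

Set Implicit Arguments.
Unset Strict Implicit.
Unset Printing Implicit Defensive.

Import Order.TTheory GRing.Theory Num.Theory.

Local Open Scope ring_scope.

(** Coordinate form of [T e_i = c i *: e_(sigma i)]; indexing the output by [sigma i] keeps the
    inverse permutation out of the formula. *)
Definition monomial_op (R : realType) (n : nat) (T : 'End('rV[R]_n))
    (sigma : 'S_n) (c : 'I_n -> R) : Prop :=
  forall x i, T x 0 (sigma i) = c i * x 0 i.

Lemma lattice_automorphism_monomial (R : realType) (n : nat)
    (T : 'End('rV[R]_n)) :
  lattice_automorphism T ->
  exists (sigma : 'S_n) (c : 'I_n -> R),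
    (forall i, 0 < c i) /\ monomial_op T sigma c.
Proof.
move=> [bijT joinT meetT].
pose e i : 'rV[R]_n := delta_mx 0 i.
have a_ge0 i k : 0 <= T (e i) 0 k.
  have e_ge0 : rv_join (e i) 0 = e i.
    by apply/rowP => j; rewrite !mxE max_l // ler0n.
  by rewrite -e_ge0 joinT linear0 !mxE le_max lexx orbT.
have a_disj i j k : i != j -> Num.min (T (e i) 0 k) (T (e j) 0 k) = 0.
  move=> ij; have eij0 : rv_meet (e i) (e j) = 0.
    apply/rowP => l; rewrite !mxE !eqxx /=.
    case: (eqVneq l i) => [->|_]; first by rewrite (negPf ij) min_r ?ler01.
    by rewrite min_l // ler0n.
  by have /rowP/(_ k) := meetT (e i) (e j); rewrite eij0 linear0 !mxE.
have ex_a i : {k | T (e i) 0 k != 0}.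
  apply/sigW/existsP; rewrite -negb_forall; apply/negP => /forallP Te0.
  have /rowP/(_ i)/eqP : e i = 0.
    apply: (bij_inj bijT); rewrite linear0; apply/rowP => k.
    by rewrite mxE; apply/eqP/Te0.
  by rewrite !mxE !eqxx oner_eq0.
(* Any coordinate in the support of [T (e i)] will do: disjointness of the supports makes [g]
   injective, hence a permutation of the finite index set. *)
pose g i := sval (ex_a i).
have a_gt0 i : 0 < T (e i) 0 (g i).
  by rewrite lt0r a_ge0 andbT; exact: (svalP (ex_a i)).
have g_inj : injective g.
  move=> i j gij; apply/eqP/negPn/negP => /(a_disj _ _ (g i)) /eqP.
  by apply/negP; rewrite gt_eqF // lt_min a_gt0 gij a_gt0.
exists (perm g_inj), (fun i => T (e i) 0 (g i)); split=> // x i.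
rewrite permE {1}[x]row_sum_delta linear_sum summxE (bigD1 i) //=.
rewrite linearZ mxE mulrC big1 ?addr0 // => j ji.
(* [T (e i)] is positive at [g i], so a zero minimum there forces [T (e j)] to vanish at [g i]. *)
rewrite linearZ mxE; have := a_disj j i (g i) ji.
rewrite minEle; case: leP => _ a0; first by rewrite a0 mulr0.
by move: (a_gt0 i); rewrite a0 ltxx.
Qed.

(** Multiplication by a positive scalar commutes with max and min, and every coordinate has the form
    [sigma i]. *)
Lemma monomial_op_lattice_automorphism (R : realType) (n : nat)
    (T : 'End('rV[R]_n)) (sigma : 'S_n) (c : 'I_n -> R) :
  (forall i, 0 < c i) -> monomial_op T sigma c -> lattice_automorphism T.
Proof.
move=> c_gt0 Tc.
pose U (y : 'rV[R]_n) : 'rV[R]_n := \row_i ((c i)^-1 * y 0 (sigma i)).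
split.
- exists U => [x | y]; apply/rowP => j.
    by rewrite mxE Tc mulKf // gt_eqF.
  by rewrite -(permKV sigma j) Tc mxE mulVKf // gt_eqF.
- move=> x y; apply/rowP => j; rewrite -(permKV sigma j).
  by rewrite Tc !mxE !Tc maxr_pMr // ltW.
- move=> x y; apply/rowP => j; rewrite -(permKV sigma j).
  by rewrite Tc !mxE !Tc minr_pMr // ltW.
Qed.

Lemma monomial_op_perm_inj (R : realType) (n : nat) (T : 'End('rV[R]_n))
    (sigma tau : 'S_n) (c d : 'I_n -> R) :
  (forall i, 0 < c i) ->
  monomial_op T sigma c -> monomial_op T tau d -> sigma = tau.
Proof.
move=> c_gt0 Tc Td; apply/permP => i.
(* Coordinate [sigma i] of [T e_i] is [c i > 0] by the first form, but 0 by the second unless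
   [tau i = sigma i]. *)
have := Td (delta_mx 0 i) ((tau^-1)%g (sigma i)); rewrite permKV Tc !mxE !eqxx.
have [ji _ | _ /eqP] := eqVneq ((tau^-1)%g (sigma i)) i.
  by rewrite -{2}ji permKV.
by rewrite mulr1 mulr0 gt_eqF.
Qed.

Lemma monomial_op_eq (R : realType) (n : nat) (T U : 'End('rV[R]_n))
    (sigma : 'S_n) (c d : 'I_n -> R) :
  c =1 d -> monomial_op T sigma c -> monomial_op U sigma d -> T = U.
Proof.
move=> cd Tc Ud; apply/lfunP => x; apply/rowP => j.
by rewrite -(permKV sigma j) Tc Ud cd.
Qed.

Lemma monomial_op_comp (R : realType) (n : nat) (T U : 'End('rV[R]_n))
    (sigma tau upsilon : 'S_n) (c d : 'I_n -> R) :
  upsilon =1 sigma \o tau -> monomial_op T sigma c -> monomial_op U tau d ->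
  monomial_op (T \o U)%VF upsilon (fun i => c (tau i) * d i).
Proof. by move=> st Tc Ud x i; rewrite st lfunE /= Tc Ud mulrA. Qed.

Lemma perm_opE (R : realType) (n : nat) (sigma : 'S_n) (x : 'rV[R]_n)
    (i : 'I_n) :
  perm_op R sigma x 0 (sigma i) = x 0 i.
Proof.
rewrite {1}[x]row_sum_delta linear_sum summxE (bigD1 i) //=.
rewrite linearZ /= perm_op_delta !mxE !eqxx mulr1 big1 ?addr0 // => j ji.
by rewrite linearZ /= perm_op_delta !mxE (inj_eq perm_inj) eq_sym (negPf ji) mulr0.
Qed.

Lemma conj_perm_op_monomial (R : realType) (n : nat) (m : 'rV[R]_n)
    (sigma : 'S_n) :
  (forall i, 0 < m 0 i) ->
  monomial_op (mul_op m \o perm_op R sigma \o (mul_op m)^-1)%VF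
    sigma (fun i => m 0 (sigma i) / m 0 i).
Proof.
move=> m_gt0 x i; rewrite !lfunE /= lfunE /= mul_opE mxE perm_opE -mulrA.
(* The inverse is abstract; its coordinates are recovered by evaluating
   [mul_op m \o (mul_op m)^-1 = \1] at [x]. *)
congr (_ * _); have [_ /lfunP/(_ x)] := mul_opV m_gt0.
rewrite comp_lfunE id_lfunE mul_opE => {2}<-.
by rewrite mxE mulKf // gt_eqF.
Qed.

Theorem theorem4p5 (R : realType) (gT : finGroupType) (n : nat)
    (hn : (1 <= n)%N) :
  (forall rho : gT -> 'End('rV[R]_n),
     positive_representation rho ->
     exists! pi : {ffun gT -> 'S_n},
       permutation_representation pi /\
       exists m : 'rV[R]_n,
         (forall i, 0 < m 0 i) /\
         forall s, rho s = (mul_op m \o perm_op R (pi s) \o (mul_op m)^-1)%VF)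
  /\
  (forall (pi : {ffun gT -> 'S_n}) (m : 'rV[R]_n),
     permutation_representation pi ->
     (forall i, 0 < m 0 i) ->
     positive_representation
       (fun s => (mul_op m \o perm_op R (pi s) \o (mul_op m)^-1)%VF)).
Proof.
split=> [rho [rho_aut rhoM] | pi m piM m_gt0]; last first.
  have mon s := conj_perm_op_monomial (pi s) m_gt0.
  split=> [s | s t].
    by apply: monomial_op_lattice_automorphism (mon s) => i; rewrite divr_gt0.
  (* The quotients of entries of [m] telescope along [i], [pi t i], [pi s (pi t i)]. *)
  apply: monomial_op_eq (mon _) (monomial_op_comp (piM s t) (mon s) (mon t)).
  by move=> i /=; rewrite piM mulrA divfK // gt_eqF.
have /fin_all_exists[pi /fin_all_exists[c rho_mon]] :
    forall s, exists (sigma : 'S_n) (c : 'I_n -> R),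
      (forall i, 0 < c i) /\ monomial_op (rho s) sigma c.
  by move=> s; apply: lattice_automorphism_monomial.
have c_gt0 s i : 0 < c s i by case: (rho_mon s).
have {}rho_mon s : monomial_op (rho s) (pi s) (c s) by case: (rho_mon s).
pose m : 'rV[R]_n := \sum_t rho t (const_mx 1).
have m_gt0 i : 0 < m 0 i.
  (* One term, here [t = 1], supplies strict positivity; the others contribute nonnegative
     amounts. *)
  rewrite summxE (bigD1 1%g) //= ltr_wpDr ?sumr_ge0 // => [t _|].
    by rewrite -(permKV (pi t) i) rho_mon mxE mulr1 ltW.
  by rewrite -(permKV (pi 1%g) i) rho_mon mxE mulr1.
have rho_m s : rho s m = m.
  rewrite linear_sum /= [RHS](reindex_inj (mulgI s)) /=.
  by apply: eq_bigr => t _; rewrite rhoM lfunE.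
exists [ffun s => pi s]; split=> [|pi' [_ [m' [m'_gt0 rhoE]]]].
  split=> [s t i|].
    (* Multiplicativity of [pi] follows from uniqueness of the permutation in the two monomial forms
       of [rho (s * t)]. The factors are swapped because the product of ['S_n] applies its left
       factor first. *)
    have st_mon : monomial_op (rho (s * t)%g) (pi t * pi s)%g
                    (fun i => c s (pi t i) * c t i).
      by rewrite rhoM; apply: monomial_op_comp => // j; rewrite permM.
    rewrite !ffunE (monomial_op_perm_inj (c_gt0 _) (rho_mon _) st_mon).
    by rewrite permM.
  exists m; split=> // s; rewrite ffunE.
  apply: monomial_op_eq (rho_mon s) (conj_perm_op_monomial (pi s) m_gt0) => i.
  by rewrite -{1}(rho_m s) rho_mon mulfK // gt_eqF.
(* Whatever [m'] is, conjugating by it only changes coefficients, so [rho s] alone determines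
   [pi' s]. *)
apply/ffunP => s; rewrite ffunE.
apply: (monomial_op_perm_inj (c_gt0 s) (rho_mon s)).
by rewrite rhoE; apply: conj_perm_op_monomial.
Qed.
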